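(* Let $\alpha\in FT_d$. Then the map $t\mapsto\mu(t\alpha)$ is weakly continuous on $(0,\infty)$. Furthermore $\lim_{t\searrow0}\mu(t\alpha)=\alpha$ in the sense of weak convergence.
   Context: $FT_d$ is the set of probabilities $\alpha$ on $\mathbb{R}^d$ with $\int\log(1+\|x\|)\alpha(dx)<\infty$. For $\alpha\in FT_d$ and $t>0$, let $B_1,Y_1,B_2,Y_2,\ldots$ be independent with $B_n\sim\alpha$ and $Y_n\sim\beta(1,t)$ (density $t(1-y)^{t-1}$ on $(0,1)$), and put $W_1=Y_1$, $W_n=Y_n(1-Y_{n-1})\cdots(1-Y_1)$ for $n>1$. The series $X_t=\sum_{n\ge1}W_nB_n$ converges absolutely almost surely, and $\mu(t\alpha)$ denotes its distribution (it is the law of $\int x\,P_t(dx)$ for a Dirichlet random probability $P_t=\sum_n W_n\delta_{B_n}\sim\mathcal{D}(t\alpha)$). *)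

(* Defs.v *)
From HB Require Import structures.
From mathcomp Require Import all_boot all_order all_algebra finmap.
From mathcomp Require Import all_classical all_reals all_analysis.

Set Implicit Arguments.
Unset Strict Implicit.
Unset Printing Implicit Defensive.

Import Order.TTheory GRing.Theory Num.Theory.
Import numFieldNormedType.Exports.

Local Open Scope classical_set_scope.
Local Open Scope ring_scope.

(* R^d with its Borel sigma-algebra. The carrier is convertible to 'rV[R]_d,
   but the alias does not inherit the vector space structure and the topology:
   cast to 'rV[R]_d to use them. *)
Definition borel_rV (R : realType) (d : nat) :=
  g_sigma_algebraType (@open 'rV[R]_d).

Definition euclidean_norm (R : realType) (d : nat) (x : 'rV[R]_d) : R :=
  Num.sqrt (\sum_(i < d) x ord0 i ^+ 2).

Definition FT (R : realType) (d : nat) (alpha : probability (borel_rV R d) R)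
    : Prop :=
  (\int[alpha]_x (ln (1 + euclidean_norm (x : 'rV[R]_d)))%:E < +oo)%E.

Definition mutually_independent (disp : measure_display)
    (T : measurableType disp) (R : realType) (P : probability T R)
    (I : choiceType) (F : I -> set_system T) : Prop :=
  forall (J : {fset I}) (E : I -> set T),
    (forall i, i \in J -> F i (E i)) ->
    (P (\bigcap_(i in [set` J]) E i) = \prod_(i <- J) P (E i))%E.

(* beta(1, t) *)
Definition beta1_law (R : realType) (t : R) (A : set R) : \bar R :=
  (\int[lebesgue_measure]_(y in A `&` `]0%R, 1%R[)
    (t * (1 - y) `^ (t - 1))%:E)%E.

(* Indices are shifted by one: B n and Y n stand for B_{n+1} and Y_{n+1}. *)
Definition stick_weight (R : realType) (Y : nat -> R) (n : nat) : R :=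
  Y n * \prod_(k < n) (1 - Y k).

(* [limn] is a total operator: where the series diverges it takes an arbitrary
   default value. This happens on a null set when alpha is in FT. *)
Definition stick_sum (R : realType) (d : nat) (Y : nat -> R)
    (B : nat -> 'rV[R]_d) : 'rV[R]_d :=
  limn (series (fun n => stick_weight Y n *: B n)).

(* nu is mu(t alpha): the law of X_t for some realization of the B_n, Y_n.
   All the B_n and Y_n together form one independent family, indexed by
   nat + nat. *)
Definition is_dirichlet_mean (R : realType) (d : nat)
    (alpha : probability (borel_rV R d) R) (t : R)
    (nu : probability (borel_rV R d) R) : Prop :=
  exists (disp : measure_display) (Omega : measurableType disp)
    (P : probability Omega R)
    (B : nat -> {RV P >-> borel_rV R d})
    (Y : nat -> {RV P >-> measurableTypeR R}),
  [/\ mutually_independent P (fun i : nat + nat =>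
        match i with
        | inl n => g_sigma_algebra_preimage (B n)
        | inr n => g_sigma_algebra_preimage (Y n)
        end),
      forall n (A : set (borel_rV R d)), measurable A ->
        distribution P (B n) A = alpha A,
      forall n (A : set (measurableTypeR R)), measurable A ->
        distribution P (Y n) A = beta1_law t A &
      forall A : set (borel_rV R d), measurable A ->
        nu A = P [set w | A (stick_sum (fun n => Y n w)
                               (fun n => B n w : 'rV[R]_d))]].

Definition weak_cvg (R : realType) (d : nat) (U : Type) (F : set_system U)
    (nu : U -> probability (borel_rV R d) R)
    (l : probability (borel_rV R d) R) : Prop :=
  forall f : 'rV[R]_d -> R, continuous f -> bounded_fun f ->
    \int[nu s]_x f x @[s --> F] --> \int[l]_x f x.

(* Main.v *)
(* If Y has law beta(1, t), then U = (1 - Y)^t is uniform on [0, 1]. Hence the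
   law of the sequence (B_n, U_n) does not depend on t, and mu(t alpha) is the law
   of X_t = sum_n (1 - U_n^(1/t)) (prod_(k < n) U_k)^(1/t) B_n
   on one probability space that serves all t > 0. For t <= T the n-th term is at
   most (prod_(k < n) U_k)^(1/T) |B_n|. Almost surely the product decays
   geometrically, and the integrability of log(1 + |B|) makes |B_n| grow
   subexponentially, both by the first Borel-Cantelli lemma. So, almost surely,
   t |-> X_t is continuous and tends to B_0 as t decreases to 0, by dominated
   convergence for series; dominated convergence for integrals concludes. *)
Require Import Defs.
From HB Require Import structures.
From mathcomp Require Import all_boot all_order all_algebra finmap.
From mathcomp Require Import all_classical all_reals all_analysis.
From mathcomp Require Import measurable_realfun.
From mathcomp Require Import ring lra.

Set Implicit Arguments.
Unset Strict Implicit.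
Unset Printing Implicit Defensive.

Import Order.TTheory GRing.Theory Num.Theory.
Import numFieldNormedType.Exports.

Local Open Scope classical_set_scope.
Local Open Scope ring_scope.

(** * Measurability in R^d *)

(** Balls of ['rV[R]_d] are boxes for the sup norm, hence finite intersections of coordinate
    conditions, and a filter is stable under these. *)
Lemma cvg_coord (R : realType) (d : nat) (U : Type) (F : set_system U)
    (FF : Filter F) (f : U -> 'rV[R]_d) (l : 'rV[R]_d) :
  f x @[x --> F] --> l <->
  forall i, f x ord0 i @[x --> F] --> l ord0 i.
Proof.
split=> [fl i|fl].
  exact: (cvg_comp _ _ fl (@coord_continuous _ _ _ ord0 i l)).
apply/cvg_ballP => e e0.
suff : F [set x | forall i, ball (l ord0 i) e (f x ord0 i)].
  by apply: filterS => x lx; split=> // j i; rewrite ord1.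
have -> : [set x | forall i, ball (l ord0 i) e (f x ord0 i)] =
    \bigcap_(i in [set` [fset i in 'I_d]%fset])
       [set x | ball (l ord0 i) e (f x ord0 i)].
  apply/seteqP; split=> x /= H i; first by move=> _; exact: H.
  by apply: H => /=; rewrite !inE.
apply: filter_bigI => i _.
by move/cvg_ballP : (fl i) => /(_ e e0).
Qed.

Section borel_rV_measurability.
Context (R : realType) (dim : nat) (disp : measure_display)
  (T : measurableType disp).

Let box (c : 'rV[R]_dim) (e : R) : set 'rV[R]_dim :=
  [set x | forall i, `|x ord0 i - c ord0 i| < e].

Lemma measurable_coord (i : 'I_dim) :
  measurable_fun setT (fun x : borel_rV R dim => (x : 'rV[R]_dim) ord0 i).
Proof.
apply: (measurability _ (RGenOInfty.measurableE R)) => _ [_ [x ->] <-].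
rewrite setTI; apply: sub_sigma_algebra; have oU := @open_gt R x.
by apply: open_comp => // y _; exact: coord_continuous.
Qed.

Lemma continuous_borel_measurable (f : 'rV[R]_dim -> R) :
  continuous f -> measurable_fun setT (f : borel_rV R dim -> R).
Proof.
move=> cf; apply: (measurability _ (RGenOInfty.measurableE R)) => _ [_ [x ->] <-].
rewrite setTI; apply: sub_sigma_algebra; have oU := @open_gt R x.
by apply: open_comp => // y _; exact: cf.
Qed.

(** An open set is the countable union of the boxes with rational centre and radius [1 / (k + 1)]
    that it contains, and the preimage of a box is a finite intersection of coordinate preimages. *)
Lemma measurable_to_borel_rV (f : T -> 'rV[R]_dim) :
  (forall i, measurable_fun setT (fun w => f w ord0 i)) ->
  measurable_fun setT (f : T -> borel_rV R dim).
Proof.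
move=> mf; apply: (@measurability _ _ T (borel_rV R dim) setT f (@open 'rV[R]_dim)) =>
  // _ [U oU <-].
rewrite setTI.
pose I : Type := ({ffun 'I_dim -> rat} * nat)%type.
pose c (p : I) : 'rV[R]_dim := \row_i ratr (p.1 i).
pose A (p : I) := box (c p) p.2.+1%:R^-1.
have -> : f @^-1` U =
    \bigcup_(p : I) (if `[< A p `<=` U >] then f @^-1` A p else set0).
  apply/seteqP; split=> [w /= Ufw|w [p _]]; last first.
    by case: ifPn => // /asboolP; exact.
  have /nbhs_ballP[e /= e0 eU] := open_nbhs_nbhs (conj oU Ufw).
  have [k ke] : exists k : nat, k.+1%:R^-1 < e / 2.
    have [k] := @ltr_add_invr R 0 (e / 2) (divr_gt0 e0 (ltr0n _ 2)).
    by rewrite add0r => ?; exists k.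
  have /choice[q qP] : forall i, exists q : rat,
      `|f w ord0 i - ratr q| < k.+1%:R^-1.
    move=> i.
    have [||r [/= H [q _ qE]]] := @dense_rat R (ball (f w ord0 i) k.+1%:R^-1).
    - by exists (f w ord0 i); exact: ballxx.
    - exact: ball_open.
    - by exists q; rewrite qE.
  exists ([ffun i => q i], k) => //.
  have -> : `[< A ([ffun i => q i], k) `<=` U >].
    apply/asboolP => x Ax; apply: eU; split => // j i.
    rewrite ord1 {j} /ball /=.
    have := qP i; have := Ax i; rewrite mxE ffunE /= => xq fq.
    rewrite (_ : _ - _ = (f w ord0 i - ratr (q i)) - (x ord0 i - ratr (q i)));
      last by ring.
    apply: (le_lt_trans (ler_normB _ _)).
    by rewrite [ltRHS]splitr ltrD// (lt_trans _ ke).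
  by move=> i /=; rewrite mxE ffunE.
apply: countable_bigcupT_measurable; first exact: countableP.
move=> p; case: ifPn => _; last exact: measurable0.
have -> : f @^-1` A p = \bigcap_(i in [set` [fset i in 'I_dim]%fset])
    ((fun w => f w ord0 i) @^-1` ball (c p ord0 i) (p.2.+1%:R^-1 : R)).
  apply/seteqP; split=> w /= H i.
    by move=> _; rewrite /ball/= distrC; exact: H.
  by rewrite distrC; apply: (H i) => /=; rewrite !inE.
rewrite bigcap_fset; apply: bigsetI_measurable => i _.
rewrite -[X in measurable X]setTI; apply: mf => //.
exact: measurable_ball.
Qed.

End borel_rV_measurability.

Lemma limn_coord (R : realType) (d : nat) (s : nat -> 'rV[R]_d) (i : 'I_d) :
  cvgn s -> (limn s) ord0 i = limn (fun n => s n ord0 i).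
Proof.
move=> /cvg_coord H.
by apply/esym/cvg_lim => //; exact: H.
Qed.

Section measurable_limn.
Context (R : realType) (disp : measure_display) (T : measurableType disp).

(** Cauchy's criterion, with the tolerance restricted to [1 / (k + 1)], uses countable quantifiers
    only. *)
Lemma measurable_cvgn (s : nat -> T -> R) :
  (forall n, measurable_fun setT (s n)) ->
  measurable [set w | cvgn (fun n => s n w)].
Proof.
move=> ms.
have -> : [set w | cvgn (fun n => s n w)] =
    \bigcap_k \bigcup_N \bigcap_n
      [set w | `|s (N + n)%N w - s N w| < k.+1%:R^-1].
  apply/seteqP; split=> w /=.
    move=> /cvgrPdist_lt cs k _.
    have e0 : 0 < k.+1%:R^-1 / 2 :> R by rewrite divr_gt0.
    have [N _ NP] := cs _ e0.
    exists N => // n _ /=.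
    rewrite (_ : _ - _ = (limn (s^~ w) - s N w) - (limn (s^~ w) - s (N + n)%N w));
      last by ring.
    rewrite (le_lt_trans (ler_normB _ _))// [ltRHS]splitr ltrD//.
      by apply: NP => /=.
    by apply: NP; rewrite /= leq_addr.
  move=> H; apply/cauchy_cvgP/cauchy_ballP => e e0.
  have [k ke] : exists k : nat, k.+1%:R^-1 < e / 2.
    have [k] := @ltr_add_invr R 0 (e / 2) (divr_gt0 e0 (ltr0n _ 2)).
    by rewrite add0r => ?; exists k.
  have [N _ NP] := H k I.
  rewrite near_map2.
  exists ([set n | (N <= n)%N], [set n | (N <= n)%N]).
    by split; exists N.
  move=> [m n] /= [Nm Nn]; rewrite /ball /=.
  rewrite (_ : _ - _ = (s m w - s N w) - (s n w - s N w)); last by ring.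
  rewrite (le_lt_trans (ler_normB _ _))// [ltRHS]splitr.
  have := NP (m - N)%N I; have := NP (n - N)%N I => /=.
  rewrite !subnKC// => ? ?.
  by rewrite ltrD// (lt_trans _ ke).
apply: bigcapT_measurable => k; apply: bigcupT_measurable => N.
apply: bigcapT_measurable => n.
rewrite -[X in measurable X]setTI.
have mf : measurable_fun setT (fun w => `|s (N + n)%N w - s N w|).
  by apply: measurableT_comp => //; exact: measurable_funB.
have := mf measurableT _ (measurable_itv (Interval -oo%O (BLeft k.+1%:R^-1))).
by congr measurable; apply/seteqP; split=> w /=; rewrite in_itv.
Qed.

Lemma measurable_limn_rV (d : nat) (s : nat -> T -> 'rV[R]_d) :
  (forall n i, measurable_fun setT (fun w => s n w ord0 i)) ->
  measurable_fun setT ((fun w => limn (fun n => s n w)) : T -> borel_rV R d).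
Proof.
move=> ms; apply: measurable_to_borel_rV => i.
pose C := [set w | cvgn (fun n => s n w)].
have mC : measurable C.
  have -> : C = \bigcap_(i in [set` [fset i in 'I_d]%fset])
      [set w | cvgn (fun n => s n w ord0 i)].
    apply/seteqP; split=> w /=.
      move=> /cvg_coord H j _; apply/cvg_ex; exists (limn (s ^~ w) ord0 j).
      exact: H.
    move=> H; apply/cvg_ex.
    exists (\row_j limn (fun n => s n w ord0 j)); apply/cvg_coord => j.
    by rewrite mxE; apply: H; rewrite /= !inE.
  rewrite bigcap_fset; apply: bigsetI_measurable => j _.
  exact: measurable_cvgn.
(* Off [C] the operator [limn] returns [point]; replacing the sequence there by this constant makes
   it converge everywhere to the value of [limn]. *)
pose h n w : R := \1_C w * s n w ord0 i + \1_(~` C) w * (point : 'rV[R]_d) ord0 i.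
apply: (@measurable_fun_cvg _ _ _ _ h).
  move=> n; apply: measurable_funD; apply: measurable_funM => //.
  by apply: measurable_indic; exact: measurableC.
move=> w _; rewrite /h; have [Cw|nCw] := pselect (C w).
  rewrite !indicE mem_set// memNset; last by move=> /(_ Cw).
  under eq_fun do rewrite mul1r mul0r addr0.
  by move/cvg_coord : Cw; exact.
rewrite !indicE memNset// mem_set//.
under eq_fun do rewrite mul1r mul0r add0r.
by rewrite dvgP//; exact: cvg_cst.
Qed.

Lemma measurable_stick_weight (y : nat -> T -> R) (n : nat) :
  (forall k, measurable_fun setT (y k)) ->
  measurable_fun setT (fun w => stick_weight (y ^~ w) n).
Proof.
move=> my; apply: measurable_funM => //.
apply: measurable_prod => k _.
by apply: measurable_funB.
Qed.

Lemma measurable_stick_sum (d : nat) (y : nat -> T -> R)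
    (b : nat -> T -> 'rV[R]_d) :
  (forall k, measurable_fun setT (y k)) ->
  (forall k, measurable_fun setT (b k : T -> borel_rV R d)) ->
  measurable_fun setT
    ((fun w => stick_sum (y ^~ w) (b ^~ w)) : T -> borel_rV R d).
Proof.
move=> my mb; apply: measurable_limn_rV => n i.
rewrite /series /=.
under eq_fun do rewrite summxE.
apply: measurable_sum => k.
under eq_fun do rewrite mxE.
apply: measurable_funM; first exact: measurable_stick_weight.
exact: (measurableT_comp (measurable_coord i)).
Qed.

End measurable_limn.

(** * The law of an independent family *)

Section independent_law.
Context (R : realType) (d : nat).

Let Zt : Type := ((nat -> 'rV[R]_d) * (nat -> R))%type.

(* The pi-system of cylinders is indexed by finite subsets of nat + nat, as is
   mutual independence. *)
Definition coord_algebra (i : nat + nat) : set_system Zt :=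
  match i with
  | inl n => g_sigma_algebra_preimage (fun z : Zt => z.1 n : borel_rV R d)
  | inr n => g_sigma_algebra_preimage (fun z : Zt => z.2 n : measurableTypeR R)
  end.

Definition cylinder : set_system Zt :=
  [set A | exists (J : {fset nat + nat}) (C : nat + nat -> set Zt),
     (forall i, coord_algebra i (C i)) /\ A = \bigcap_(i in [set` J]) C i].

Definition seq_space := g_sigma_algebraType cylinder.

Lemma coord_algebra_sigma i : sigma_algebra setT (coord_algebra i).
Proof.
by case: i => n; apply: sigma_algebra_preimage; exact: sigma_algebra_measurable.
Qed.

Lemma coord_algebraT i : coord_algebra i setT.
Proof.
have [h0 hD _] := coord_algebra_sigma i.
by rewrite -(setD0 setT); exact: hD.
Qed.

Lemma coord_algebraI i A B :
  coord_algebra i A -> coord_algebra i B -> coord_algebra i (A `&` B).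
Proof.
case: i => n [A' mA <-] [B' mB <-]; exists (A' `&` B');
  by [exact: measurableI|rewrite preimage_setI setIIr].
Qed.

Lemma cylinder_setI_closed : setI_closed cylinder.
Proof.
move=> _ _ [J1 [C1 [m1 ->]]] [J2 [C2 [m2 ->]]].
(* Outside its own index set each cylinder gets the factor [setT], so that both range over the
   union. *)
exists (J1 `|` J2)%fset, (fun i => (if i \in J1 then C1 i else setT) `&`
  (if i \in J2 then C2 i else setT)); split.
  by move=> i; apply: coord_algebraI; case: ifP => // _; exact: coord_algebraT.
apply/seteqP; split => z /=.
  move=> [H1 H2] i /= _; split; case: ifPn => // iJ; [exact: H1|exact: H2].
by move=> H; split=> i /= iJ; have := H i; rewrite /= inE iJ ?orbT/=;
  move=> /(_ isT) [].
Qed.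

Lemma coord_algebra_measurable i A :
  coord_algebra i A -> measurable (A : set seq_space).
Proof.
move=> mA; apply: sub_sigma_algebra; exists [fset i]%fset.
exists (fun j => if j == i then A else setT); split.
  by move=> j; case: eqP => [->//|_]; exact: coord_algebraT.
apply/seteqP; split=> z /=; last by move=> /(_ i); rewrite /= inE eqxx; exact.
by move=> Az j /=; rewrite inE => /eqP ->; rewrite eqxx.
Qed.

Lemma measurable_seq_space_fst n :
  measurable_fun setT (fun z : seq_space => z.1 n : borel_rV R d).
Proof.
by move=> _ A mA; apply: (@coord_algebra_measurable (inl n)); exists A.
Qed.

Lemma measurable_seq_space_snd n :
  measurable_fun setT (fun z : seq_space => z.2 n : measurableTypeR R).
Proof.
by move=> _ A mA; apply: (@coord_algebra_measurable (inr n)); exists A.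
Qed.

Section pair.
Context (disp : measure_display) (T : measurableType disp).
Variables (B : nat -> T -> borel_rV R d) (U : nat -> T -> measurableTypeR R).
Hypotheses (mB : forall n, measurable_fun setT (B n))
  (mU : forall n, measurable_fun setT (U n)).

Definition seq_pair (w : T) : seq_space := (B ^~ w, U ^~ w).

Lemma seq_pair_coord i C : coord_algebra i C ->
  match i with
  | inl n => g_sigma_algebra_preimage (B n)
  | inr n => g_sigma_algebra_preimage (U n)
  end (seq_pair @^-1` C).
Proof. by case: i => n [A mA <-]; exists A => //; rewrite !setTI. Qed.

Lemma measurable_seq_pair : measurable_fun setT seq_pair.
Proof.
apply: (@measurability _ _ T seq_space setT seq_pair cylinder) => //.
move=> _ [_ [J [C [mC ->]]] <-].
rewrite setTI preimage_bigcap bigcap_fset; apply: bigsetI_measurable => i _.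
have := seq_pair_coord (mC i).
by case: i => n [A mA <-]; [exact: mB|exact: mU].
Qed.

End pair.

(** Both laws on [seq_space] agree on cylinders, where independence factors the probability into
    one-coordinate terms; cylinders are a generating pi-system, so the laws agree. *)
Lemma independent_law_unique (d1 d2 : measure_display)
    (T1 : measurableType d1) (T2 : measurableType d2)
    (P1 : probability T1 R) (P2 : probability T2 R)
    (B1 : nat -> T1 -> borel_rV R d) (U1 : nat -> T1 -> measurableTypeR R)
    (B2 : nat -> T2 -> borel_rV R d) (U2 : nat -> T2 -> measurableTypeR R) :
  (forall n, measurable_fun setT (B1 n)) ->
  (forall n, measurable_fun setT (U1 n)) ->
  (forall n, measurable_fun setT (B2 n)) ->
  (forall n, measurable_fun setT (U2 n)) ->
  mutually_independent P1 (fun i : nat + nat =>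
    match i with
    | inl n => g_sigma_algebra_preimage (B1 n)
    | inr n => g_sigma_algebra_preimage (U1 n)
    end) ->
  mutually_independent P2 (fun i : nat + nat =>
    match i with
    | inl n => g_sigma_algebra_preimage (B2 n)
    | inr n => g_sigma_algebra_preimage (U2 n)
    end) ->
  (forall n A, measurable A -> P1 (B1 n @^-1` A) = P2 (B2 n @^-1` A)) ->
  (forall n A, measurable A -> P1 (U1 n @^-1` A) = P2 (U2 n @^-1` A)) ->
  forall A : set seq_space, measurable A ->
    P1 (seq_pair B1 U1 @^-1` A) = P2 (seq_pair B2 U2 @^-1` A).
Proof.
move=> mB1 mU1 mB2 mU2 ind1 ind2 eB eU A mA.
pose z1 : {mfun T1 >-> seq_space} := mfun_Sub (mem_set (measurable_seq_pair mB1 mU1)).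
pose z2 : {mfun T2 >-> seq_space} := mfun_Sub (mem_set (measurable_seq_pair mB2 mU2)).
have := @measure_unique _ R seq_space cylinder (fun=> setT) erefl
  cylinder_setI_closed _ _ (distribution P1 z1) (distribution P2 z2) _ _ A mA.
apply.
- move=> _; exists fset0, (fun=> setT); split.
    by move=> i; exact: coord_algebraT.
  by apply/seteqP; split.
- by rewrite bigcup_const//; exists 0%N.
- move=> _ [J [C [mC ->]]].
  change (P1 (seq_pair B1 U1 @^-1` \bigcap_(i in [set` J]) C i) =
    P2 (seq_pair B2 U2 @^-1` \bigcap_(i in [set` J]) C i)).
  rewrite !preimage_bigcap.
  rewrite ind1 ?ind2; last 2 first.
  + by move=> i _; exact: seq_pair_coord.
  + by move=> i _; exact: seq_pair_coord.
  apply: eq_bigr => i _; have := mC i.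
  by case: i => n [D mD <-]; rewrite setTI; [exact: eB|exact: eU].
- by move=> k; apply: (le_lt_trans (probability_le1 _ _)) => //; rewrite ltry.
Qed.

End independent_law.

(** * From beta to uniform variables *)

Section beta1_cdf.
Context (R : realType).

Lemma is_derive_onem_powR (t x : R) : x < 1 ->
  is_derive x (1 : R) (fun y => - (1 - y) `^ t) (t * (1 - x) `^ (t - 1)).
Proof.
move=> x1.
have H : is_derive x (1 : R) (fun y : R => 1 - y) (-1).
  by rewrite -[-1]add0r; apply: is_deriveB.
have G := @is_derive1_powR R t (1 - x); rewrite subr_gt0 in G.
have K := @is_derive1_comp R (fun z : R => z `^ t) (fun y => 1 - y) x _ _ (G x1) H.
have L : is_derive x (1 : R) (- ((fun z : R => z `^ t) \o (fun y => 1 - y)))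
  (- (t * (1 - x) `^ (t - 1) * -1)) by exact: is_deriveN.
by move: L; rewrite mulrN1 opprK.
Qed.

Lemma measurable_beta1_density (t : R) (D : set R) :
  measurable_fun D (fun y => (t * (1 - y) `^ (t - 1))%:E).
Proof.
apply/measurable_EFinP; apply: measurable_funM => //.
have mB : measurable_fun D (fun y : R => 1 - y) by exact: measurable_funB.
exact: (measurableT_comp (measurable_powR (t - 1)) mB).
Qed.

(** The fundamental theorem of calculus with the primitive of [is_derive_onem_powR]; [y < 1] keeps
    away from the endpoint [1], where the density blows up when [0 < t < 1]. *)
Lemma integral_beta1_density (t y : R) : 0 < y < 1 ->
  (\int[lebesgue_measure]_(s in `]0%R, y[) (t * (1 - s) `^ (t - 1))%:E =
   (1 - (1 - y) `^ t)%:E)%E.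
Proof.
move=> /andP[y0 y1].
rewrite -(@integral_itv_bndoo R 0 y _ true false); last first.
  exact: measurable_beta1_density.
have dF (x : R) : x < 1 -> is_derive x (1 : R) (fun y => - (1 - y) `^ t)
  (t * (1 - x) `^ (t - 1)) := @is_derive_onem_powR t x.
have cF (a x : R) : x < 1 -> {for x, continuous (fun z : R => - (1 - z) `^ a : R)}.
  move=> x1; apply: differentiable_continuous; apply/derivable1_diffP.
  by have [] := @is_derive_onem_powR a x x1.
rewrite (@continuous_FTC2 _ _ (fun y => - (1 - y) `^ t)) => //=.
- by rewrite subr0 powR1 -EFinB opprK addrC.
- apply: continuous_in_subspaceT => x; rewrite inE /= in_itv /= => /andP[_ xy].
  apply: (@cvgM _ _ _ _ (fun=> t) (fun y : R => (1 - y) `^ (t - 1)));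
    first exact: cvg_cst.
  have -> : (fun y : R => (1 - y) `^ (t - 1)) =
      - (fun y : R => - (1 - y) `^ (t - 1)).
    by apply/funext => z; rewrite fctE opprK.
  rewrite -[X in _ --> X]opprK; apply: cvgN.
  exact: cF (le_lt_trans xy y1).
- split.
  + move=> x; rewrite in_itv /= => /andP[_ xy].
    by have [] := dF x (lt_trans xy y1).
  + by apply: cvg_at_right_filter; exact: cF.
  + by apply: cvg_at_left_filter; exact: cF.
- move=> x; rewrite in_itv /= => /andP[_ xy].
  by rewrite derive1E; have [_ ->] := dF x (lt_trans xy y1).
Qed.

Section law.
Context (disp : measure_display) (T : measurableType disp)
  (P : probability T R) (Y : T -> R) (t : R).
Hypothesis t0 : 0 < t.
Hypothesis mY : measurable_fun setT Y.
Hypothesis hY : forall A, measurable A -> P (Y @^-1` A) = beta1_law t A.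

Lemma beta1_ae_itv : {ae P, forall w, 0 < Y w < 1}.
Proof.
exists (Y @^-1` (~` `]0, 1[)); split.
- by rewrite -[X in measurable X]setTI; apply: mY => //; exact: measurableC.
- transitivity (P (Y @^-1` (~` `]0%R, 1%R[))); first by [].
  rewrite hY ?/beta1_law; last exact: measurableC.
  by rewrite setICl integral_set0.
- by move=> w /= H; rewrite in_itv.
Qed.

(* The right-hand side is P(U > c) for U uniform on [0, 1]. *)
Lemma beta1_powR_uniform (c : R) :
  P [set w | c < (1 - Y w) `^ t] = (Num.max 0 (Num.min 1 (1 - c)))%:E.
Proof.
have p1 (s : R) : 1 `^ s = 1 by rewrite powR1.
pose A := [set y : R | c < (1 - y) `^ t].
have mA : measurable A.
  have -> : A = setT `&` (fun y : R => (1 - y) `^ t) @^-1` `]c, +oo[.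
    by rewrite setTI; apply/seteqP; split => y /=; rewrite in_itv /= andbT.
  have mf : measurable_fun setT (fun y : R => (1 - y) `^ t).
    have mB : measurable_fun setT (fun y : R => 1 - y) by exact: measurable_funB.
    exact: (measurableT_comp (measurable_powR t) mB).
  exact: mf.
have -> : [set w | c < (1 - Y w) `^ t] = Y @^-1` A by [].
rewrite hY //; have [c0|c0] := leP c 0.
- rewrite min_l ?max_r//; last by lra.
  (* The total mass is [1] because [beta1_law t] is the law of [Y]; no integral is computed. *)
  transitivity (beta1_law t setT); last first.
    by rewrite -hY// preimage_setT probability_setT.
  rewrite /beta1_law; congr (\int[_]_(x in _) _)%E; rewrite setTI.
  apply/seteqP; split=> y /=; rewrite in_itv /=; first by case.
  move=> /andP[y0 y1]; split; last by rewrite y0.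
  by rewrite /A /= (le_lt_trans c0)// powR_gt0// subr_gt0.
have [c1|c1] := leP 1 c.
- rewrite min_r ?max_l; [|by lra..].
  rewrite /beta1_law (_ : _ `&` _ = set0) ?integral_set0//.
  apply/seteqP; split=> y //= -[]; rewrite /A/= in_itv /= => cy /andP[y0 y1].
  suff : (1 - y) `^ t <= 1 by lra.
  rewrite -[leRHS](p1 t); apply: ge0_ler_powR; rewrite ?nnegrE ?(ltW t0)//; lra.
(* For [0 < c < 1] the condition [c < (1 - y) ^ t] reads [y < y0], so the integral runs over []0,
   y0[]. *)
pose y0 := 1 - c `^ t^-1.
have ct0 : 0 < c `^ t^-1 by exact: powR_gt0.
have cK : (c `^ t^-1) `^ t = c.
  by rewrite -powRrM mulVf ?gt_eqF// powRr1// ltW.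
have ct1 : c `^ t^-1 < 1.
  rewrite -[ltRHS](p1 t^-1); apply: gt0_ltr_powR; rewrite ?nnegrE ?invr_gt0//.
  exact: ltW.
rewrite min_r ?max_r; [|by lra..].
rewrite -[in RHS]cK (_ : c `^ t^-1 = 1 - y0); last by rewrite /y0; ring.
rewrite -integral_beta1_density; last by rewrite /y0; lra.
rewrite /beta1_law; congr (\int[_]_(x in _) _)%E.
apply/seteqP; split=> y; rewrite /A /= !in_itv /= => -[].
- move=> cy /andP[-> y1] /=; rewrite ltNge; apply/negP => yy.
  move: cy; rewrite -{1}cK; apply/negP; rewrite -leNgt.
  by apply: ge0_ler_powR; rewrite ?nnegrE ?(ltW t0) ?(ltW ct0)//;
    move: yy; rewrite /y0; lra.
- move=> /andP[yp yy]; move: yy; rewrite /y0 => yy; split; last by lra.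
  rewrite -{1}cK; apply: gt0_ltr_powR; rewrite ?nnegrE ?(ltW ct0)//; lra.
Qed.

End law.
End beta1_cdf.

Lemma ae_eq_measure (R : realType) (disp : measure_display)
    (T : measurableType disp) (P : {measure set T -> \bar R}) (A B : set T) :
  measurable A -> measurable B -> {ae P, forall w, A w <-> B w} -> P A = P B.
Proof.
move=> mA mB [N [mN N0 AB]].
have le C D : measurable C -> measurable D ->
    (forall w, ~ N w -> C w -> D w) -> (P C <= P D)%E.
  move=> mC mD CD; rewrite (@le_trans _ _ (P (D `|` N)))//.
    apply: le_measure; rewrite ?inE//; first exact: measurableU.
    by move=> w Cw; have [?|nN] := pselect (N w); [right|left; exact: CD].
  by rewrite (le_trans (measureU2 _ _ _))// [X in (_ + X)%E]N0 adde0.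
have nAB w : ~ N w -> A w <-> B w by move=> nN; apply: contrapT => /AB.
by apply/eqP; rewrite eq_le !le// => w /nAB H /H.
Qed.

(** The half-lines []x, +oo[] form a pi-system generating the Borel sets. *)
Lemma ccdf_law_unique (R : realType) (d1 d2 : measure_display)
    (T1 : measurableType d1) (T2 : measurableType d2)
    (P1 : probability T1 R) (P2 : probability T2 R)
    (U1 : T1 -> measurableTypeR R) (U2 : T2 -> measurableTypeR R) :
  measurable_fun setT U1 -> measurable_fun setT U2 ->
  (forall c : R, P1 [set w | c < U1 w] = P2 [set w | c < U2 w]) ->
  forall A, measurable A -> P1 (U1 @^-1` A) = P2 (U2 @^-1` A).
Proof.
move=> mU1 mU2 U12 A mA.
pose z1 : {mfun T1 >-> measurableTypeR R} := mfun_Sub (mem_set mU1).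
pose z2 : {mfun T2 >-> measurableTypeR R} := mfun_Sub (mem_set mU2).
have := @measure_unique _ R (measurableTypeR R) _ (fun k => `](- k%:R), +oo[%classic)
  (RGenOInfty.measurableE R)
  _ _ _ (distribution P1 z1) (distribution P2 z2) _ _ A mA.
apply.
- move=> _ _ [x ->] [y ->]; exists (Num.max x y).
  apply/seteqP; split=> z /=; rewrite !in_itv /= !andbT gt_max.
    by case=> -> ->.
  by move=> /andP[].
- by move=> k; exists (- k%:R).
- apply/seteqP; split=> // x _; exists (Num.bound `|x|) => //=.
  rewrite in_itv /= andbT ltrNl (le_lt_trans _ (archi_boundP _))//.
  by rewrite -normrN ler_norm.
- move=> _ [x ->].
  have E (T : Type) (U : T -> R) : U @^-1` `]x, +oo[ = [set w | x < U w].
    by apply/seteqP; split=> w /=; rewrite in_itv /= andbT.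
  change (P1 (U1 @^-1` `]x, +oo[) = P2 (U2 @^-1` `]x, +oo[)).
  by rewrite !E.
- by move=> k; apply: (le_lt_trans (probability_le1 _ _)) => //; rewrite ltry.
Qed.

Section seed.
Context (R : realType) (d : nat) (alpha : probability (borel_rV R d) R).

(* [U n] stands for (1 - Y_n)^t with Y_n of law beta(1, t): it is uniform on
   [0, 1], whatever t. *)
Definition is_seed (disp : measure_display) (T : measurableType disp)
    (P : probability T R) (B : nat -> T -> borel_rV R d)
    (U : nat -> T -> measurableTypeR R) : Prop :=
  [/\ (forall n, measurable_fun setT (B n) /\ measurable_fun setT (U n)),
      {ae P, forall w n, 0 <= U n w < 1},
      mutually_independent P (fun i : nat + nat =>
        match i with
        | inl n => g_sigma_algebra_preimage (B n)
        | inr n => g_sigma_algebra_preimage (U n)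
        end),
      (forall n A, measurable A -> P (B n @^-1` A) = alpha A) &
      (forall n (c : R),
        P [set w | c < U n w] = (Num.max 0 (Num.min 1 (1 - c)))%:E)].

(** The map [u |-> 1 - u ^ (1 / t)] inverts [y |-> (1 - y) ^ t]: this is [X_t] as a function of data
    whose law is free of [t]. *)
Definition seed_mean (t : R) (b : nat -> 'rV[R]_d) (u : nat -> R) : 'rV[R]_d :=
  stick_sum (fun n => 1 - u n `^ t^-1) b.

Lemma measurable_seed_mean (disp : measure_display) (T : measurableType disp)
    (t : R) (B : nat -> T -> borel_rV R d) (U : nat -> T -> R) :
  (forall n, measurable_fun setT (B n)) ->
  (forall n, measurable_fun setT (U n)) ->
  measurable_fun setT
    ((fun w => seed_mean t (B ^~ w) (U ^~ w)) : T -> borel_rV R d).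
Proof.
move=> mB mU.
apply: (@measurable_stick_sum _ _ _ _ (fun n w => 1 - U n w `^ t^-1) B) => // n.
apply: measurable_funB => //.
exact: (measurableT_comp (measurable_powR t^-1) (mU n)).
Qed.

(** The seed is built on the given space with [U = (1 - Y) ^ t]. It stays independent because an
    event of [U n] is an event of [Y n], and almost surely all [Y n] lie in []0, 1[], where
    [1 - U ^ (1 / t)] gives back [Y]. *)
Lemma dirichlet_mean_seed (t : R) (nu : probability (borel_rV R d) R) :
  0 < t -> is_dirichlet_mean alpha t nu ->
  exists (disp : measure_display) (T : measurableType disp)
    (P : probability T R) (B : nat -> T -> borel_rV R d)
    (U : nat -> T -> measurableTypeR R),
    is_seed P B U /\
    forall A, measurable A ->
      nu A = P [set w | A (seed_mean t (B ^~ w) (U ^~ w))].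
Proof.
move=> t0 [disp [T [P [B [Y [ind hB hY hnu]]]]]].
have mB n : measurable_fun setT (B n : T -> borel_rV R d) by [].
have mY n : measurable_fun setT (Y n : T -> measurableTypeR R) by [].
have mf : measurable_fun setT (fun y : R => (1 - y) `^ t).
  have mB1 : measurable_fun setT (fun y : R => 1 - y) by exact: measurable_funB.
  exact: (measurableT_comp (measurable_powR t) mB1).
pose U n w : measurableTypeR R := (1 - Y n w) `^ t.
have mU n : measurable_fun setT (U n) by exact: (measurableT_comp mf (mY n)).
have /ae_foralln Y01 := fun n => beta1_ae_itv (mY n) (hY n).
exists disp, T, P, (fun n => B n), U; split; first split=> //.
- apply: filterS Y01 => w Hw n; have /andP[y0 y1] := Hw n.
  have p1 : 1 `^ t = 1 :> R by rewrite powR1.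
  rewrite powR_ge0 /= -[ltRHS]p1.
  by apply: gt0_ltr_powR; rewrite ?nnegrE//; lra.
- move=> J E HE; apply: ind => i /HE; case: i => n // [A mA <-].
  rewrite setTI; exists ((fun y : R => (1 - y) `^ t) @^-1` A).
    by rewrite -[X in measurable X]setTI; exact: mf.
  by rewrite setTI.
- by move=> n c; apply: (beta1_powR_uniform t0 (hY n)).
- move=> A mA; rewrite hnu//; apply: ae_eq_measure.
  + rewrite -[X in measurable X]setTI.
    by apply: (measurable_stick_sum mY mB).
  + rewrite -[X in measurable X]setTI.
    by apply: (measurable_seed_mean t mB mU).
  + apply: filterS Y01 => w Hw.
    change (A (stick_sum (fun n => Y n w) (fun n => B n w)) <->
      A (stick_sum (fun n => 1 - U n w `^ t^-1) (fun n => B n w))).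
    suff -> : (fun n => 1 - U n w `^ t^-1) = (fun n => Y n w) by [].
    apply/funext => n; have /andP[y0 y1] := Hw n.
    rewrite /U -powRrM mulfV ?gt_eqF// powRr1 ?subr_ge0 ?ltW//.
    by rewrite opprB addrC subrK.
Qed.

(** The law of a measurable function of the sequences depends only on their joint law, which is the
    same for all seeds. This moves the realizations for the various [t] to one space. *)
Lemma seed_mean_law (d1 d2 : measure_display)
    (T1 : measurableType d1) (T2 : measurableType d2)
    (P1 : probability T1 R) (P2 : probability T2 R)
    (B1 : nat -> T1 -> borel_rV R d) (U1 : nat -> T1 -> measurableTypeR R)
    (B2 : nat -> T2 -> borel_rV R d) (U2 : nat -> T2 -> measurableTypeR R)
    (t : R) (A : set (borel_rV R d)) :
  is_seed P1 B1 U1 -> is_seed P2 B2 U2 -> measurable A ->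
  P1 [set w | A (seed_mean t (B1 ^~ w) (U1 ^~ w))] =
  P2 [set w | A (seed_mean t (B2 ^~ w) (U2 ^~ w))].
Proof.
move=> [/all_and2[mB1 mU1] _ ind1 hB1 hU1] [/all_and2[mB2 mU2] _ ind2 hB2 hU2] mA.
apply: (independent_law_unique mB1 mU1 mB2 mU2 ind1 ind2 _ _
  (A := [set z : seq_space R d | A (seed_mean t z.1 z.2)])).
- by move=> n D mD; rewrite hB1// hB2.
- by move=> n; apply: ccdf_law_unique => // c; rewrite hU1 hU2.
- rewrite -[X in measurable X]setTI.
  apply: (@measurable_seed_mean _ (seq_space R d) t
    (fun n z => z.1 n) (fun n z => z.2 n)) => // n.
    exact: measurable_seq_space_fst.
  exact: measurable_seq_space_snd.
Qed.

End seed.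

(** * Almost sure growth estimates *)

(** The first Borel-Cantelli lemma; the exceptional null set is the limit superior of the [F n]. *)
Lemma borel_cantelli_near (R : realType) (disp : measure_display)
    (T : measurableType disp) (P : {measure set T -> \bar R})
    (F : nat -> set T) (M : R) :
  (forall k, measurable (F k)) ->
  (forall N, (\sum_(0 <= k < N) P (F k) <= M%:E)%E) ->
  {ae P, forall w, \forall n \near \oo, ~ F n w}.
Proof.
move=> mF FM; exists (lim_sup_set F); split.
- apply: bigcapT_measurable => n; apply: bigcup_measurable => k _; exact: mF.
- apply: lim_sup_set_cvg0 => //; rewrite (@le_lt_trans _ _ M%:E) ?ltry//.
  apply: lime_le; first by apply: is_cvg_nneseries => n _ _.
  by apply: nearW => n; exact: FM.
- move=> w /= H n _; apply: contrapT => nF; apply: H.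
  by exists n => // k /= nk Fk; apply: nF; exists k.
Qed.

Section tail_sum.
Context (R : realType) (disp : measure_display) (T : measurableType disp)
  (P : probability T R).

(** Induction on [N]: if the last indicator is [1], then [N < v / e] and each earlier term is at
    most [1]; otherwise the last term is [0]. *)
Lemma sum_indic_tail (v e : R) (N : nat) : 0 < e -> 0 <= v ->
  \sum_(0 <= k < N) ((k%:R * e < v)%R%:R : R) <= 1 + v / e.
Proof.
move=> e0 v0; elim: N => [|N IH].
  by rewrite big_nil addr_ge0// divr_ge0// ltW.
rewrite big_nat_recr//=; case: ltP => [Nv|_]; last by rewrite addr0.
rewrite addrC lerD2l (@le_trans _ _ N%:R)//; last first.
  by rewrite ler_pdivlMr// ltW.
rewrite -[leRHS](_ : \sum_(0 <= k < N) 1 = _).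
  by apply: ler_sum => k _; case: ltP.
by rewrite big_const_nat subn0 iter_addr_0.
Qed.

(** Summing the indicators under the integral by [sum_indic_tail] gives the bound [E[1 + V / e]],
    which is finite. *)
Lemma sum_tail_bound (V : T -> R) (e : R) : 0 < e ->
  measurable_fun setT V -> (forall w, 0 <= V w) ->
  (\int[P]_w (V w)%:E < +oo)%E ->
  exists M : R, forall N,
    (\sum_(0 <= k < N) P [set w | (k%:R * e < V w)%R] <= M%:E)%E.
Proof.
move=> e0 mV V0 iV.
have ei0 : 0 <= e^-1 by rewrite invr_ge0 ltW.
have mVe : measurable_fun setT (fun w => (e^-1 * V w)%:E).
  by apply/measurable_EFinP; exact: measurable_funM.
have iVe : (\int[P]_w (1 + e^-1 * V w)%:E < +oo)%E.
  under eq_integral do rewrite EFinD.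
  rewrite ge0_integralD//; last first.
  - by move=> w _; rewrite lee_fin mulr_ge0.
  under [X in (_ + X)%E]eq_integral do rewrite EFinM.
  rewrite ge0_integralZl_EFin//; last 2 first.
  - by move=> w _; rewrite lee_fin.
  - by apply/measurable_EFinP.
  rewrite integral_cst// mul1e lte_add_pinfty//.
    by rewrite (le_lt_trans (probability_le1 _ _))// ltry.
  by rewrite lte_mul_pinfty.
have mA k : measurable [set w | k%:R * e < V w].
  have -> : [set w | k%:R * e < V w] = setT `&` V @^-1` `]k%:R * e, +oo[.
    by rewrite setTI; apply/seteqP; split => y /=; rewrite in_itv /= andbT.
  exact: mV.
exists (fine (\int[P]_w (1 + e^-1 * V w)%:E)) => N.
have i0 : (0 <= \int[P]_w (1 + e^-1 * V w)%:E)%E.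
  by apply: integral_ge0 => w _; rewrite lee_fin addr_ge0// mulr_ge0.
rewrite fineK; last by rewrite ge0_fin_numE.
under eq_bigr do rewrite -[X in P X]setIT -integral_indic//.
rewrite -ge0_integral_sum//; last first.
  by move=> k; apply/measurable_EFinP; exact: measurable_indic.
apply: ge0_le_integral => //.
- by move=> w _; apply: sume_ge0 => k _; rewrite lee_fin.
- under eq_fun do rewrite sumEFin.
  apply/measurable_EFinP; apply: measurable_sum => k.
  exact: measurable_indic.
- apply/measurable_EFinP; apply: measurable_funD => //.
  exact: measurable_funM.
- move=> w _; rewrite sumEFin lee_fin mulrC.
  apply: le_trans (sum_indic_tail N e0 (V0 w)).
  apply: ler_sum => k _; rewrite indicE.
  by have [/set_mem/= ->|//] := boolP (w \in _).
Qed.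

End tail_sum.

Section product_tail.
Context (R : realType) (disp : measure_display) (T : measurableType disp)
  (P : probability T R) (u : nat -> T -> R).
Hypothesis mu : forall n, measurable_fun setT (u n).
Hypothesis hu : forall J : {fset nat},
  P (\bigcap_(k in [set` J]) [set w | 2^-1 < u k w]) = (2^-1 ^+ #|` J|)%:E.

(** A two-valued majorant of [u n] when [u n <= 1]; products of the [X k] involve the events [D k]
    only, whose joint probabilities are given by [hu]. *)
Let X n w : R := if 2^-1 < u n w then 1 else 2^-1.
Let D n := [set w | 2^-1 < u n w].

Let mD n : measurable (D n).
Proof.
have -> : D n = setT `&` u n @^-1` `]2^-1, +oo[.
  by rewrite setTI; apply/seteqP; split => y /=; rewrite in_itv /= andbT.
exact: mu.
Qed.

Let mX n c : measurable [set w | c < \prod_(k < n) X k w].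
Proof.
have H : measurable_fun setT (fun w => \prod_(k < n) X k w).
  apply: measurable_prod => k _; apply: measurable_fun_ifT => //.
  exact: measurable_fun_ltr.
have -> : [set w | c < \prod_(k < n) X k w] =
    setT `&` (fun w => \prod_(k < n) X k w) @^-1` `]c, +oo[.
  by rewrite setTI; apply/seteqP; split => y /=; rewrite in_itv /= andbT.
exact: H.
Qed.

(* Markov's inequality for the square of the product, with
   E[X_k^2] <= 1/4 + 1/2; the intersection over [J], a set of later indices,
   lets the induction use independence without any integral. *)
Lemma product_tail (n : nat) (J : {fset nat}) (c : R) : 0 < c ->
  (forall k, k \in J -> (n <= k)%N) ->
  (P (\bigcap_(k in [set` J]) D k `&` [set w | (c < \prod_(k < n) X k w)%R]) <=
   ((3 / 4) ^+ n * 2^-1 ^+ #|` J| / c ^+ 2)%:E)%E.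
Proof.
elim: n J c => [|n IH] J c c0 Jn.
  (* The empty product is [1]: for [c < 1] the factor [1 / c ^ 2] exceeds [1], and for [c >= 1] the
     event is empty. *)
  have [c1|c1] := ltP c 1.
    rewrite (_ : [set w | c < \prod_(k < 0) X k w] = setT); last first.
      by apply/seteqP; split=> w //= _; rewrite big_ord0.
    rewrite setIT hu lee_fin expr0 mul1r ler_pdivlMr ?exprn_gt0//.
    by rewrite ler_piMr ?exprn_ge0// expr_le1// ltW.
  rewrite (_ : [set w | c < \prod_(k < 0) X k w] = set0); last first.
    by apply/seteqP; split=> w //=; rewrite big_ord0 ltNge c1.
  by rewrite setI0 measure0 lee_fin divr_ge0 ?exprn_ge0// ?mulr_ge0 ?exprn_ge0// ltW.
have mJ K : measurable (\bigcap_(k in [set` K : {fset nat}]) D k).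
  by rewrite bigcap_fset; apply: bigsetI_measurable.
have nJ : n \notin J by apply/negP => /Jn; rewrite ltnn.
(* If [u n <= 1 / 2] the factor [X n] doubles the threshold, which divides the bound by [4]; if
   [u n > 1 / 2] the index [n] joins [J], which divides it by [2]. *)
have sub : \bigcap_(k in [set` J]) D k `&` [set w | c < \prod_(k < n.+1) X k w]
    `<=` (\bigcap_(k in [set` J]) D k `&` [set w | 2 * c < \prod_(k < n) X k w])
     `|` (\bigcap_(k in [set` (n |` J)%fset]) D k `&`
         [set w | c < \prod_(k < n) X k w]).
  move=> w [Jw]; rewrite /= big_ord_recr /= /X; case: ifPn => Dn.
    rewrite mulr1 => cw; right; split=> // k; rewrite /= !inE => /orP[/eqP->//|].
    exact: Jw.
  by move=> cw; left; split=> //=; move: cw; rewrite ltr_pdivlMr// mulrC.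
have c20 : 0 < 2 * c by rewrite mulr_gt0.
rewrite (le_trans (le_measure _ _ _ sub))// ?inE//.
- exact: measurableI.
- by apply: measurableU; exact: measurableI.
rewrite (le_trans (measureU2 _ _ _))//; [exact: measurableI..|].
apply: le_trans (leeD (IH J _ c20 _) (IH (n |` J)%fset _ c0 _)) _.
- by move=> k /Jn /ltnW.
- by move=> k; rewrite !inE => /orP[/eqP->//|/Jn /ltnW].
rewrite cardfsU1 nJ -EFinD lee_fin add1n !exprS.
move: ((3 / 4) ^+ n) (2^-1 ^+ _) => a b.
rewrite le_eqVlt; apply/orP; left; apply/eqP; field.
by rewrite gt_eqF.
Qed.

Lemma product_le_geometric :
  {ae P, forall w, \forall n \near \oo,
    \prod_(k < n) X k w <= (7 / 8) ^+ n}.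
Proof.
pose F n := [set w | (7 / 8) ^+ n < \prod_(k < n) X k w].
(* [48 / 49] is [(3 / 4) / (7 / 8) ^ 2]: the rate [7 / 8] is chosen with square above [3 / 4], which
   makes these bounds summable, with sum [49]. *)
have PF n : (P (F n) <= ((48 / 49) ^+ n)%:E)%E.
  have c0 : 0 < (7 / 8 : R) ^+ n by apply: exprn_gt0; lra.
  have := @product_tail n fset0 _ c0; rewrite cardfs0 expr0 mulr1.
  rewrite (_ : \bigcap_(k in _) _ = setT) ?setTI; last by apply/seteqP; split.
  move=> /(_ _)/le_trans; apply => //; rewrite lee_fin.
  by rewrite -exprM mulnC exprM -expr_div_n le_eqVlt; apply/orP; left; apply/eqP;
    congr (_ ^+ n); field.
have FM N : (\sum_(0 <= k < N) P (F k) <= 49%:E)%E.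
  apply: (@le_trans _ _ (\sum_(0 <= k < N) ((48 / 49) ^+ k)%:E)%E).
    by apply: lee_sum => k _; exact: PF.
  rewrite sumEFin lee_fin.
  have -> : \sum_(0 <= k < N) (48 / 49 : R) ^+ k = 49 * (1 - (48 / 49) ^+ N).
    elim: N => [|N IH]; first by rewrite big_nil expr0 subrr mulr0.
    by rewrite big_nat_recr//= IH exprS; field.
  by have : 0 <= (48 / 49 : R) ^+ N by [apply: exprn_ge0; lra]; lra.
have := borel_cantelli_near (fun n => mX n ((7 / 8) ^+ n)) FM.
apply: filterS => w; apply: filterS => n /negP; by rewrite -leNgt.
Qed.

End product_tail.

Section euclidean_norm.
Context (R : realType) (d : nat).

Lemma measurable_ln_euclidean_norm :
  measurable_fun setT
    (fun x : borel_rV R d => ln (1 + euclidean_norm (x : 'rV[R]_d))).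
Proof.
apply: (measurableT_comp (@measurable_ln R)).
apply: measurable_funD => //.
apply: measurableT_comp.
  by apply: continuous_measurable_fun; exact: sqrt_continuous.
apply: measurable_sum => i; apply: measurable_funX.
exact: measurable_coord.
Qed.

Lemma ler_coord_euclidean_norm (x : 'rV[R]_d) (i : 'I_d) :
  `|x ord0 i| <= euclidean_norm x.
Proof.
rewrite -sqrtr_sqr; apply: ler_wsqrtr.
rewrite (bigD1 i)//= lerDl; apply: sumr_ge0 => j _; exact: sqr_ge0.
Qed.

End euclidean_norm.

Section growth.
Context (R : realType) (d : nat) (alpha : probability (borel_rV R d) R).

(** The path properties behind the continuity in [t], free of probability. The last one, required at
    every rate [1 / (m + 1)], is subexponential growth of [b n]; for any [T] it is beaten by the
    power [1 / T] of the geometric decay of the products. The strict bound [u n < 1] makes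
    [u n ^ (1 / s)] tend to [0] with [s]. *)
Definition tempered (b : nat -> 'rV[R]_d) (u : nat -> R) : Prop :=
  [/\ forall n, 0 <= u n < 1,
     \forall n \near \oo, \prod_(k < n) u k <= (7 / 8) ^+ n &
     forall m, \forall n \near \oo,
       ln (1 + euclidean_norm (b n)) <= n%:R * m.+1%:R^-1].

(** [product_le_geometric] handles the products, and Borel-Cantelli with [sum_tail_bound] for
    [V = ln (1 + |x|)], integrable by [FT], handles the growth at each rate. *)
Lemma seed_tempered (disp : measure_display) (T : measurableType disp)
    (P : probability T R) (B : nat -> T -> borel_rV R d)
    (U : nat -> T -> measurableTypeR R) :
  FT alpha -> is_seed alpha P B U ->
  {ae P, forall w, tempered (B ^~ w) (U ^~ w)}.
Proof.
move=> hF [/all_and2[mB mU] U01 ind hB hU].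
have H2 : {ae P, forall w, \forall n \near \oo,
    \prod_(k < n) (if 2^-1 < U k w then 1 else 2^-1) <= (7 / 8 : R) ^+ n}.
  apply: (@product_le_geometric _ _ _ P U mU) => J.
  pose D n := [set w | 2^-1 < U n w].
  (* Independence is applied to the indices [inr k] only, each event [D k] having probability
     [1 / 2]. *)
  have := ind (inr @` J)%fset (fun i => if i is inr n then D n else setT).
  have -> : \bigcap_(i in [set` (inr @` J)%fset])
      (fun i : nat + nat => if i is inr n then D n else setT) i =
      \bigcap_(k in [set` J]) D k.
    apply/seteqP; split=> w /= H i.
      by move=> iJ; apply: (H (inr i)) => /=; rewrite mem_imfset// => ? ? [].
    by move=> /imfsetP[k /= kJ ->]; exact: H.
  move=> ->; last first.
    move=> _ /imfsetP[k /= kJ ->]; exists `]2^-1, +oo[%classic => //.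
    by rewrite setTI; apply/seteqP; split=> w /=; rewrite in_itv /= andbT.
  rewrite big_imfset/=; last by move=> ? ? _ _ [].
  under eq_bigr => k _.
    rewrite /D hU (_ : Num.max _ _ = 2^-1); last first.
      by rewrite min_r ?max_r; lra.
    over.
  elim: (enum_fset J) => [|k s IH]; first by rewrite big_nil.
  by rewrite big_cons IH exprS.
have H3 : {ae P, forall w m, \forall n \near \oo,
    ln (1 + euclidean_norm (B n w : 'rV[R]_d)) <= n%:R * m.+1%:R^-1}.
  apply: ae_foralln => m.
  have e0 : 0 < m.+1%:R^-1 :> R by [].
  have V0 (x : borel_rV R d) : 0 <= ln (1 + euclidean_norm (x : 'rV[R]_d)).
    by rewrite ln_ge0// lerDl sqrtr_ge0.
  (* The tail sums are bounded under [alpha], then carried over to [P] since each [B n] has law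
     [alpha]. *)
  have [M HM] := sum_tail_bound e0 (@measurable_ln_euclidean_norm R d) V0 hF.
  have mA n : measurable [set x : borel_rV R d |
      n%:R * m.+1%:R^-1 < ln (1 + euclidean_norm (x : 'rV[R]_d))].
    have := @measurable_ln_euclidean_norm R d measurableT
      `]n%:R * m.+1%:R^-1, +oo[%classic.
    rewrite setTI (_ : _ @^-1` _ = [set x : borel_rV R d |
      n%:R * m.+1%:R^-1 < ln (1 + euclidean_norm (x : 'rV[R]_d))]); first exact.
    by apply/seteqP; split => y /=; rewrite in_itv /= andbT.
  have := @borel_cantelli_near _ _ _ P (fun n => B n @^-1` [set x : borel_rV R d |
      n%:R * m.+1%:R^-1 < ln (1 + euclidean_norm (x : 'rV[R]_d))]) M _ _.
  move=> H; apply: filterS (H _ _).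
  - by move=> w; apply: filterS => n /negP; rewrite -leNgt.
  - by move=> n; rewrite -[X in measurable X]setTI; exact: mB.
  - move=> N; apply: le_trans (HM N); apply: lee_sum => n _.
    rewrite le_eqVlt; apply/orP; left; apply/eqP; exact: hB (mA n).
apply: filterS3 U01 H2 H3 => w u01 pu bu; split=> //.
apply: filterS pu => n; apply: le_trans; apply: ler_prod => k _.
have /andP[-> u1] /= := u01 k.
by case: ltP => // _; exact: ltW.
Qed.

End growth.

(** * Continuity of the paths *)

Section tannery.
Context (R : realType).

Lemma series_tail_le (x M : nat -> R) (N : nat) :
  (forall n, `|x n| <= M n) -> cvgn (series M) ->
  cvgn (series x) /\ `|limn (series x) - series x N| <= limn (series M) - series M N.
Proof.
move=> xM cM.
have M0 n : 0 <= M n by exact: le_trans (xM n).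
have cx : cvgn (series x).
  apply: normed_cvg; apply: (series_le_cvg _ _ xM) => //.
have tail n : (N <= n)%N -> `|series x n - series x N| <= series M n - series M N.
  move=> Nn; rewrite !sub_series_geq//; apply: le_trans (ler_norm_sum _ _ _) _.
  exact: ler_sum.
split=> //.
have cxN : `|series x n - series x N| @[n --> \oo] --> `|limn (series x) - series x N|.
  by apply: cvg_norm; apply: cvgB => //; exact: cvg_cst.
apply: (cvgr_to_le cxN); near=> n.
apply: (@le_trans _ _ (series M n - series M N)).
  by apply: tail; near: n; exists N.
rewrite lerD2r; apply: nondecreasing_cvgn_le => //.
exact: nondecreasing_series.
Unshelve. all: by end_near. Qed.

(** Tannery's theorem. Cut at an [N] where the tail of [M] is at most [e / 3]: both tails are small
    uniformly in [s], and the partial sums of length [N] converge. *)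
Lemma dominated_series_cvg (U : Type) (F : set_system U) (FF : ProperFilter F)
    (a : U -> nat -> R) (M l : nat -> R) :
  (\forall s \near F, forall n, `|a s n| <= M n) -> cvgn (series M) ->
  (forall n, a s n @[s --> F] --> l n) ->
  limn (series (a s)) @[s --> F] --> limn (series l).
Proof.
move=> aM cM al.
have lM n : `|l n| <= M n.
  apply: (cvgr_to_le (cvg_norm (al n))).
  by apply: filterS aM => s; exact.
have cS N : series (a s) N @[s --> F] --> series l N.
  elim: N => [|N IH].
    by rewrite /series /= big_geq//; under eq_fun do rewrite big_geq//; exact: cvg_cst.
  rewrite /series /= big_nat_recr//=; under eq_fun do rewrite big_nat_recr//=.
  exact: cvgD.
apply/cvgrPdist_le => /= e e0.
have e30 : 0 < e / 3 by rewrite divr_gt0.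
have [N _ NP] := cvgr_dist_le _ _ cM _ e30.
have MN : limn (series M) - series M N <= e / 3.
  by apply: le_trans (NP N _) => //=; exact: ler_norm.
have [_ lN] := series_tail_le N lM cM.
near=> s.
have [_ sN] : cvgn (series (a s)) /\
    `|limn (series (a s)) - series (a s) N| <= limn (series M) - series M N.
  by apply: series_tail_le => //; near: s.
have asN : `|series l N - series (a s) N| <= e / 3.
  by near: s; exact: cvgr_dist_le _ _ (cS N) _ e30.
rewrite (_ : _ - _ = (limn (series l) - series l N) +
  (series l N - series (a s) N) - (limn (series (a s)) - series (a s) N)); last by ring.
apply: le_trans (ler_normB _ _) _.
apply: le_trans (lerD (ler_normD _ _) (lexx _)) _.
lra.
Unshelve. all: by end_near. Qed.

End tannery.

Section stick_weight_cvg.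
Context (R : realType).

Lemma stick_weight_cvg (U : Type) (F : set_system U) (FF : Filter F)
    (v : U -> nat -> R) (c : nat -> R) (n : nat) :
  (forall k, v s k @[s --> F] --> c k) ->
  stick_weight (v s) n @[s --> F] --> stick_weight c n.
Proof.
move=> vc; apply: cvgM; first exact: vc.
elim: n => [|n IH].
  by rewrite big_ord0; under eq_fun do rewrite big_ord0; exact: cvg_cst.
rewrite big_ord_recr/=; under eq_fun do rewrite big_ord_recr/=.
by apply: cvgM => //; apply: cvgB; [exact: cvg_cst|exact: vc].
Qed.

Lemma powRV_cvg (x t : R) : 0 <= x -> 0 < t ->
  x `^ s^-1 @[s --> t] --> x `^ t^-1.
Proof.
move=> x0 t0; have [->|xn0] := eqVneq x 0.
  (* At [x = 0] the power is [0] for a nonzero exponent, so it is constant near [t]; elsewhere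
     [x ^ a] is [expR (a * ln x)]. *)
  rewrite powR0 ?invr_eq0 ?gt_eqF//; apply: cvg_near_cst.
  near=> s; rewrite powR0// invr_eq0 gt_eqF//.
  by near: s; exact: lt_nbhsr.
rewrite /powR (negbTE xn0).
apply: (@cvg_comp _ _ _ (fun s : R => s^-1 * ln x) expR);
  last exact: continuous_expR.
apply: cvgM; last exact: cvg_cst.
by apply: cvgV; rewrite ?gt_eqF//; exact: cvg_id.
Unshelve. all: by end_near. Qed.

(** For [x > 0] and [L = - ln x > 0], [x ^ (1 / s) = exp (- L / s)] is at most [s / L], because
    [exp (L / s) >= 1 + L / s]. *)
Lemma powRV_cvg0 (x : R) : 0 <= x < 1 -> x `^ s^-1 @[s --> 0^'+] --> (0 : R).
Proof.
move=> /andP[x0 x1].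
have [->|xn0] := eqVneq x 0.
  apply: cvg_near_cst; near=> s; rewrite powR0// invr_eq0 gt_eqF//.
have lx : 0 < - ln x by rewrite oppr_gt0 ln_lt0// x1 andbT lt_neqAle eq_sym xn0.
have sq : s / (- ln x) @[s --> 0^'+] --> (0 : R).
  rewrite -[X in _ --> X](mul0r (- ln x)^-1); apply: cvgM; last exact: cvg_cst.
  by apply: cvg_at_right_filter; exact: cvg_id.
apply: (squeeze_cvgr _ (cvg_cst 0) sq); near=> s.
have s0 : 0 < s by [].
rewrite powR_ge0 /= /powR (negbTE xn0).
rewrite -[leLHS]invrK -expRN -[leRHS]invrK lef_pV2 ?posrE ?invr_gt0 ?divr_gt0 ?expR_gt0//.
rewrite invf_div -mulrN mulrC (le_trans _ (expR_ge1Dx _))//.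
by rewrite lerDr.
Unshelve. all: by end_near. Qed.

End stick_weight_cvg.

Section tempered.
Context (R : realType) (d : nat) (b : nat -> 'rV[R]_d) (u : nat -> R).
Hypothesis bu : tempered b u.

Let y (s : R) (k : nat) : R := 1 - u k `^ s^-1.

Let M (T : R) (i : 'I_d) (n : nat) : R :=
  (\prod_(k < n) u k) `^ T^-1 * `|b n ord0 i|.

Let prod_u_ge0 n : 0 <= \prod_(k < n) u k.
Proof. by case: bu => u01 _ _; apply: prodr_ge0 => k _; have /andP[] := u01 k. Qed.

Let powR_prod (s : R) n : \prod_(k < n) u k `^ s = (\prod_(k < n) u k) `^ s.
Proof.
case: bu => u01 _ _; elim: n => [|n IH]; first by rewrite !big_ord0 powR1.
by rewrite !big_ord_recr/= IH powRM ?prod_u_ge0//; have /andP[] := u01 n.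
Qed.

(** The factor [1 - u n ^ (1 / s)] is at most [1], and since [u k < 1] the powers [u k ^ (1 / s)]
    are nondecreasing in [s]. *)
Lemma tempered_term_le (T s : R) (i : 'I_d) (n : nat) : 0 < s <= T ->
  `|stick_weight (y s) n * b n ord0 i| <= M T i n.
Proof.
move=> /andP[s0 sT]; case: bu => u01 _ _.
have T0 : 0 < T := lt_le_trans s0 sT.
have Ts : T^-1 <= s^-1 by rewrite lef_pV2.
have v1 k : u k `^ s^-1 <= u k `^ T^-1.
  have /andP[u0 u1] := u01 k; have [->|un0] := eqVneq (u k) 0.
    by rewrite !powR0// invr_eq0 gt_eqF.
  by apply: ger_powR => //; rewrite lt_neqAle eq_sym un0 u0 ltW.
rewrite normrM ler_wpM2r// /stick_weight /y normrM -[leRHS]mul1r.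
apply: ler_pM => //.
  have /andP[u0 u1] := u01 n.
  rewrite ger0_norm ?gerBl ?powR_ge0// subr_ge0.
  have p1 : 1 `^ s^-1 = 1 :> R by rewrite powR1.
  rewrite -[leRHS]p1; apply: ge0_ler_powR; rewrite ?nnegrE ?invr_ge0 ?(ltW s0)//.
  exact: ltW.
rewrite -powR_prod (eq_bigr (fun k : 'I_n => u k `^ s^-1)); last first.
  by move=> k _; rewrite opprB addrC subrK.
rewrite ger0_norm; last by apply: prodr_ge0 => k _; exact: powR_ge0.
by apply: ler_prod => k _; rewrite powR_ge0 v1.
Qed.

(** The product contributes at most [exp (- n * de)] and the growth of [b] at most
    [exp (n / (m + 1))]; with [1 / (m + 1) < de] the terms are eventually below a geometric sequence
    of ratio [rho < 1]. *)
Lemma tempered_summable (T : R) (i : 'I_d) : 0 < T -> cvgn (series (M T i)).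
Proof.
move=> T0; case: bu => u01 pu gb.
pose de := - (T^-1 * ln (7 / 8)) : R.
have de0 : 0 < de.
  by rewrite oppr_gt0 pmulr_rlt0 ?invr_gt0// ln_lt0//; lra.
have [m mde] : exists m : nat, m.+1%:R^-1 < de.
  by have [m] := @ltr_add_invr R 0 de de0; rewrite add0r => ?; exists m.
pose rho : R := expR (m.+1%:R^-1 - de).
have [N _ NP] : \forall n \near \oo, M T i n <= rho ^+ n.
  near=> n; rewrite /M.
  have -> : rho ^+ n = ((7 / 8) ^+ n) `^ T^-1 * expR (n%:R * m.+1%:R^-1).
    have p0 : 0 < (7 / 8 : R) ^+ n by apply: exprn_gt0; lra.
    rewrite /powR gt_eqF// -expRD -expRM_natl; congr expR.
    rewrite /de lnXn; last by lra.
    by rewrite -mulr_natl; ring.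
  apply: ler_pM => //; first exact: powR_ge0.
    apply: ge0_ler_powR; rewrite ?nnegrE ?invr_ge0 ?(ltW T0) ?prod_u_ge0 ?exprn_ge0//.
    by near: n.
  apply: (le_trans (ler_coord_euclidean_norm _ _)).
  apply: (@le_trans _ _ (1 + euclidean_norm (b n))); first by rewrite lerDr.
  rewrite -[leLHS]lnK; last by rewrite posrE ltr_pwDl// sqrtr_ge0.
  by rewrite ler_expR; near: n; exact: gb.
rewrite -(is_cvg_series_restrict N).
(* The bound holds from [N] on only; the earlier terms are set to [0], which does not affect
   convergence. *)
pose M' n := if (n < N)%N then 0 else M T i n.
have M0 n : 0 <= M T i n by rewrite mulr_ge0// powR_ge0.
have -> : (fun n => \sum_(N <= k < n) M T i k) =
    (fun n => \sum_(N <= k < n) M' k).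
  apply/funext => n; apply: eq_big_nat => k /andP[Nk _].
  by rewrite /M' ltnNge Nk.
rewrite is_cvg_series_restrict.
apply: (@series_le_cvg _ _ (geometric 1 rho)).
- by move=> n; rewrite /M'; case: ifP.
- by move=> n; rewrite /= mul1r exprn_ge0// expR_ge0.
- move=> n; rewrite /M' /= mul1r; case: ltnP => Nn; last exact: NP.
  by rewrite exprn_ge0// expR_ge0.
- apply: is_cvg_geometric_series; rewrite ger0_norm ?expR_ge0//.
  by rewrite expR_lt1; rewrite subr_lt0.
Unshelve. all: by end_near. Qed.

(** Coordinates commute with [limn] once the series converges, which the majorant with [T = s]
    ensures. *)
Lemma tempered_seed_mean_coord (s : R) (i : 'I_d) : 0 < s ->
  seed_mean s b u ord0 i =
  limn (series (fun n => stick_weight (y s) n * b n ord0 i)).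
Proof.
move=> s0.
have E (j : 'I_d) : (fun n => (series (fun n => stick_weight (y s) n *: b n) n) ord0 j)
    = series (fun n => stick_weight (y s) n * b n ord0 j).
  by apply/funext => n; rewrite /series /= summxE; apply: eq_bigr => k _; rewrite mxE.
rewrite /seed_mean /stick_sum limn_coord ?E//.
apply/cvg_ex; exists (\row_j limn (series (fun n => stick_weight (y s) n * b n ord0 j))).
apply/cvg_coord => j; rewrite mxE E.
have ss : 0 < s <= s by rewrite s0 lexx.
by have [] := series_tail_le 0 (fun n => tempered_term_le j n ss)
  (tempered_summable s0).
Qed.

(** The common form of both limits, at [t] and at [0]: [c] is the limit of the powers
    [u k ^ (1 / s)], and [l] is identified through the limiting series. *)
Let seed_mean_cvg (F : set_system R) (FF : ProperFilter F) (T : R)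
    (c : nat -> R) (l : 'rV[R]_d) :
  (\forall s \near F, 0 < s <= T) ->
  (forall k, u k `^ s^-1 @[s --> F] --> c k) ->
  (forall i, limn (series (fun n =>
    stick_weight (fun k => 1 - c k) n * b n ord0 i)) = l ord0 i) ->
  seed_mean s b u @[s --> F] --> l.
Proof.
move=> nearF uc cl; apply/cvg_coord => i; rewrite -cl.
have T0 : 0 < T.
  have [s /andP[s0 sT]] := filter_ex nearF; exact: lt_le_trans sT.
have : limn (series (fun n => stick_weight (y s) n * b n ord0 i)) @[s --> F] -->
  limn (series (fun n => stick_weight (fun k => 1 - c k) n * b n ord0 i)).
  apply: (@dominated_series_cvg _ _ _ _
    (fun s n => stick_weight (y s) n * b n ord0 i) (M T i)).
  - by apply: filterS nearF => s sT n; exact: tempered_term_le.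
  - exact: tempered_summable.
  move=> n; apply: cvgM; last exact: cvg_cst.
  apply: stick_weight_cvg => k; apply: cvgB; first exact: cvg_cst.
  exact: uc.
apply: cvg_trans; apply: near_eq_cvg.
near=> s; rewrite tempered_seed_mean_coord//.
by have /andP[] : 0 < s <= T by near: s.
Unshelve. all: by end_near. Qed.

Lemma tempered_continuous (t : R) : 0 < t ->
  seed_mean s b u @[s --> t] --> seed_mean t b u.
Proof.
move=> t0; case: (bu) => u01 _ _.
apply: (@seed_mean_cvg (nbhs t) _ (t + 1) (fun k => u k `^ t^-1)).
- near=> s; apply/andP; split; first by near: s; exact: lt_nbhsr.
  by apply/ltW; near: s; apply: lt_nbhsl; rewrite ltrDl.
- by move=> k; apply: powRV_cvg => //; have /andP[] := u01 k.
- by move=> i; rewrite tempered_seed_mean_coord.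
Unshelve. all: by end_near. Qed.

(** All powers tend to [0], so in the limit the first weight is [1] and every later one contains the
    factor [1 - 1 = 0]. *)
Lemma tempered_at_right0 : seed_mean s b u @[s --> 0^'+] --> b 0%N.
Proof.
case: (bu) => u01 _ _.
apply: (@seed_mean_cvg (0^'+) _ 1 (fun=> 0)).
- near=> s; apply/andP; split=> //.
  by near: s; exact: nbhs_right_le.
- by move=> k; apply: powRV_cvg0.
- move=> i; apply/cvg_lim => //; apply: cvg_near_cst.
  (* The partial sum of index [0] is empty; from index [1] on it equals the first term. *)
  near=> n; have n0 : (0 < n)%N by near: n; exists 1%N.
  rewrite /series /= -(prednK n0) big_nat_recl// big1 ?addr0.
    by rewrite /stick_weight big_ord0 subr0 !mul1r.
  move=> k _.
  by rewrite /stick_weight big_ord_recl subr0 subrr mul0r mulr0 mul0r.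
Unshelve. all: by end_near. Qed.

End tempered.

(** * Weak convergence from almost sure convergence *)

Section weak_limits.
Context (R : realType) (d : nat) (disp : measure_display)
  (T : measurableType disp) (P : probability T R).

Lemma bounded_integrable (g : T -> R) (K : R) :
  measurable_fun setT g -> (forall w, `|g w| <= K) ->
  P.-integrable setT (EFin \o g).
Proof.
move=> mg gK.
apply: (@le_integrable _ _ _ _ _ measurableT _ (EFin \o cst K)).
- exact/measurable_EFinP.
- by move=> w _; rewrite /= lee_fin (le_trans (gK w))// ler_norm.
- exact: finite_measure_integrable_cst.
Qed.

Lemma Rintegral_law (nu : probability (borel_rV R d) R)
    (X : T -> borel_rV R d) (f : 'rV[R]_d -> R) (K : R) :
  measurable_fun setT X ->
  (forall A, measurable A -> nu A = P (X @^-1` A)) ->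
  continuous f -> (forall x, `|f x| <= K) ->
  \int[nu]_x f x = \int[P]_w f (X w).
Proof.
move=> mX nuX cf fK; rewrite /Rintegral; congr fine.
pose X' : {mfun T >-> borel_rV R d} := mfun_Sub (mem_set mX).
rewrite (eq_measure_integral (distribution P X')); last first.
  by move=> A mA _; exact: nuX.
have mf : measurable_fun setT (f : borel_rV R d -> R).
  exact: continuous_borel_measurable.
rewrite integral_pushforward// ?preimage_setT//; first exact/measurable_EFinP.
apply: (@bounded_integrable _ K) => //.
exact: (measurableT_comp mf mX).
Qed.

Lemma Rintegral_ae_cvg (X : nat -> T -> borel_rV R d) (X0 : T -> borel_rV R d)
    (f : 'rV[R]_d -> R) (K : R) :
  (forall n, measurable_fun setT (X n)) -> measurable_fun setT X0 ->
  {ae P, forall w, (X n w : 'rV[R]_d) @[n --> \oo] --> (X0 w : 'rV[R]_d)} ->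
  continuous f -> (forall x, `|f x| <= K) ->
  \int[P]_w f (X n w) @[n --> \oo] --> \int[P]_w f (X0 w).
Proof.
move=> mX mX0 XX0 cf fK.
have mf : measurable_fun setT (f : borel_rV R d -> R).
  exact: continuous_borel_measurable.
have mfX n : measurable_fun setT (f \o X n) by exact: measurableT_comp.
have mfX0 : measurable_fun setT (f \o X0) by exact: measurableT_comp.
have iX0 := @bounded_integrable (f \o X0) K mfX0 (fun w => fK (X0 w)).
have mE n : measurable_fun setT (fun w => (f (X n w))%:E).
  by apply/measurable_EFinP; exact: mfX.
have mE0 : measurable_fun setT (fun w => (f (X0 w))%:E).
  by apply/measurable_EFinP; exact: mfX0.
have fX : {ae P, forall w, setT w ->
    (f (X n w))%:E @[n --> \oo] --> (f (X0 w))%:E}.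
  apply: filterS XX0 => w Xw _; apply: cvg_EFin; first exact: nearW.
  exact: (cvg_comp _ _ Xw (cf _)).
have dom : {ae P, forall w n, setT w -> `|(f (X n w))%:E| <= (cst K w)%:E}%E.
  by apply: aeW => w n _; rewrite /= lee_fin.
have [_ _ H] := dominated_convergence measurableT mE mE0 fX
  (finite_measure_integrable_cst P K measurableT) dom.
apply: fine_cvg; rewrite fineK//.
exact: integrable_fin_num iX0.
Qed.

End weak_limits.

Theorem proposition3p4 (R : realType) (d : nat)
    (alpha : probability (borel_rV R d) R) (halpha : FT alpha)
    (mu : R -> probability (borel_rV R d) R)
    (hmu : forall t : R, 0 < t -> is_dirichlet_mean alpha t (mu t)) :
  (forall t : R, 0 < t -> weak_cvg (within `]0, +oo[ (nbhs t)) mu (mu t)) /\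
  weak_cvg (at_right 0) mu alpha.
Proof.
(* The realization for [t = 1] provides the one space and the one seed used for every [t]. *)
have [disp [T [P [B [U [sd _]]]]]] := dirichlet_mean_seed ltr01 (hmu 1 ltr01).
have ae_tempered := seed_tempered halpha sd.
have [/all_and2[mB mU] _ _ hB _] := sd.
pose X (t : R) (w : T) : borel_rV R d := seed_mean t (B ^~ w) (U ^~ w).
have mX t : measurable_fun setT (X t) by exact: measurable_seed_mean.
(* The realization given for [t] lives on its own space; its law is that of [X t] because both come
   from seeds. *)
have law t A : 0 < t -> measurable A -> mu t A = P (X t @^-1` A).
  move=> t0 mA.
  have [disp' [T' [P' [B' [U' [sd' ->]]]]]] := dirichlet_mean_seed t0 (hmu t t0).
    exact: (seed_mean_law t sd' sd mA).
  exact: mA.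
have bound (f : 'rV[R]_d -> R) : bounded_fun f ->
    exists K, forall x, `|f x| <= K.
  move=> [K [_ fK]]; exists (K + 1) => x.
  by apply: (fK (K + 1)) => //; rewrite ltrDl.
have mean (f : 'rV[R]_d -> R) K t : continuous f -> (forall x, `|f x| <= K) ->
    0 < t -> \int[mu t]_x f x = \int[P]_w f (X t w).
  move=> cf fK t0; apply: Rintegral_law cf fK => // A mA.
  exact: law.
split=> [t t0|] f cf /bound[K fK].
- rewrite (mean f K t)//.
  have : \int[P]_w f (X s w) @[s --> t] --> \int[P]_w f (X t w).
    (* Sequences tending to [t] suffice, and along each of them dominated convergence applies. *)
    apply/(@cvg_nbhsP _ R^o) => s st.
    apply: (Rintegral_ae_cvg _ _ _ cf fK) => //.
    apply: filterS ae_tempered => w /tempered_continuous cX.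
    exact: (cvg_comp _ _ st (cX _ t0)).
  move=> H A /H HA.
  (* [mu s] is known to be the law of [X s] for [s > 0] only, which is what [within] provides. *)
  change (nbhs t [set s | `]0, +oo[%classic s -> A (\int[mu s]_x f x)]).
  have {}HA : nbhs t [set s | A (\int[P]_w f (X s w))] by exact: HA.
  apply: filterS HA => s As; rewrite /= in_itv /= andbT => s0.
  by rewrite (mean f K).
(* [alpha] is realized on the same space as the law of [B 0], the almost sure limit at [0]. *)
- rewrite (@Rintegral_law _ _ _ _ P alpha (B 0%N) f K)//; last first.
    by move=> A mA; rewrite hB.
  have : \int[P]_w f (X s w) @[s --> 0^'+] --> \int[P]_w f (B 0%N w).
    apply/cvg_at_rightP => s [s0 st].
    apply: (Rintegral_ae_cvg _ _ _ cf fK) => //.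
    apply: filterS ae_tempered => w /tempered_at_right0 cX.
    apply: (cvg_comp _ _ _ cX) => A /st sA.
    have {}sA : \forall n \near \oo, 0 < s n -> A (s n) by exact: sA.
    change (\forall n \near \oo, A (s n)).
    by apply: filterS sA => n; exact.
  apply: cvg_trans; apply: near_eq_cvg; near=> s.
  by rewrite (mean f K).
Unshelve. all: by end_near. Qed.
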